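(* Let $\Delta t>0$ with $c_F\Delta t<2\beta_3$, and let $(U^n)_{n\ge0}$ be a bounded sequence in $\mathbb{R}^M$ which complies with the BDF3 scheme $$\frac{11}{6}U^{n+3}-3U^{n+2}+\frac32U^{n+1}-\frac13U^n\in-\Delta t\,\partial F(U^{n+3}),\quad n\ge0.$$ Let $\beta\in[c_F\Delta t/2,\beta_3)$. If the function $\hat F_3^\beta:(\mathbb{R}^M)^3\to\mathbb{R}\cup\{+\infty\}$ has the Kurdyka-{\L}ojasiewicz property at some point $(U^\star,0,0)$ in $(\mathbb{R}^M)^3$ where $U^\star\in\omega((U^n)_n)$, then the whole sequence $(U^n)_n$ converges to $U^\star$.
   Context: Assumptions on $F$. $\mathbb{R}^M$ carries the Euclidean norm $\|\cdot\|$ and scalar product $\langle\cdot,\cdot\rangle$. $F:\mathbb{R}^M\to\mathbb{R}\cup\{+\infty\}$ is proper and lower semicontinuous, and semiconvex: there is a constant $c\ge0$ such that $V\mapsto F(V)+\frac{c}{2}\|V\|^2$ is convex; $c_F\ge0$ denotes the smallest such constant. Moreover $F$ is continuous on its domain $\mathrm{dom}(F)=\{V: F(V)<+\infty\}$, and $\inf_{\mathbb{R}^M}F>-\infty$. The subdifferential $\partial F$ is the set-valued map on $\mathbb{R}^M$ defined by $$W\in\partial F(V)\iff\forall V'\in\mathbb{R}^M,\ F(V')\ge F(V)+\langle W,V'-V\rangle-\frac{c_F}{2}\|V'-V\|^2,$$ with $\partial F(V)=\emptyset$ if $V\notin\mathrm{dom}(F)$. The $\omega$-limit set is $\omega((U^n)_n)=\{U^\star\in\mathbb{R}^M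 : \exists\, n_p\to+\infty\text{ such that }U^{n_p}\to U^\star\}$. The constant $\beta_3$ and the quadratic forms. Let $\gamma_3(x_1,x_2,x_3)=\frac{11}{6}x_1^2-\frac76x_1x_2+\frac13x_1x_3$ on $\mathbb{R}^3$. $\beta_3$ is the supremum of the real numbers $\beta>0$ for which there exist a positive definite quadratic form $q_3$ on $\mathbb{R}^2$ and a positive definite quadratic form $\tilde r_3$ on $\mathbb{R}^3$ with $$\gamma_3(x_1,x_2,x_3)=q_3(x_1,x_2)-q_3(x_2,x_3)+\tilde r_3(x_1,x_2,x_3)+\beta x_1^2\quad\text{for all }(x_1,x_2,x_3)\in\mathbb{R}^3;$$ its value is $\beta_3=95/96$. For each $\beta<\beta_3$ such a pair of positive definite forms exists; fix one and denote it $q_3^\beta$, $\tilde r_3^\beta$. Writing $q_3^\beta(x_1,x_2)=a x_1^2+2b x_1x_2+c x_2^2$, the associated quadratic form on $(\mathbb{R}^M)^2$ is $Q_3^\beta(V_1,V_2)=a\|V_1\|^2+2b\langle V_1,V_2\rangle+c\|V_2\|^2$. The functional. For $\hat V=(V_0,V_1,V_2)\in(\mathbb{R}^M)^3$, $$\hat F_3^\beta(\hat V)=F(V_0)+\frac{1}{\Delta t}Q_3^\beta(V_1,V_2).$$ It is proper, lower semicontinuous and semiconvex; its subdifferential is $$\partial\hat F_3^\beta(V_0,V_1,V_2)=\partial F(V_0)\times\left\{\tfrac{1}{\Delta t}(2aV_1+2bV_2)\right\}\times\left\{\tfrac{1}{\Delta t}(2bV_1+2cV_2)\right\}.$$ Kurdyka-{\L}ojasiewicz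 property. A proper lower semicontinuous function $\Phi:\mathbb{R}^N\to\mathbb{R}\cup\{+\infty\}$ with (limiting) subdifferential $\partial\Phi$ (for $\Phi=\hat F_3^\beta$, the one given above) has the Kurdyka-{\L}ojasiewicz property at a point $x^\star$ with $\partial\Phi(x^\star)\ne\emptyset$ if there exist $\eta\in(0,+\infty]$, a neighbourhood $\mathcal{U}$ of $x^\star$ and a continuous concave function $\varphi:[0,\eta)\to[0,+\infty)$ such that $\varphi(0)=0$, $\varphi$ is $C^1$ on $(0,\eta)$, $\varphi'>0$ on $(0,\eta)$, and for all $x\in\mathcal{U}$ with $\Phi(x^\star)<\Phi(x)<\Phi(x^\star)+\eta$, $$\varphi'(\Phi(x)-\Phi(x^\star))\,\mathrm{dist}(0,\partial\Phi(x))\ge1,$$ where $\mathrm{dist}(0,\emptyset)=+\infty$. *)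

(* Defs.v *)
From HB Require Import structures.
From mathcomp Require Import all_boot all_order all_algebra.
From mathcomp Require Import all_classical all_reals all_analysis.
From mathcomp Require Import ring lra.

Set Implicit Arguments.
Unset Strict Implicit.
Unset Printing Implicit Defensive.

Import Order.TTheory GRing.Theory Num.Theory.
Import numFieldNormedType.Exports.

Local Open Scope classical_set_scope.
Local Open Scope ring_scope.

(* The library norm on 'rV[R]_M is the sup norm; it induces the same topology
   as the Euclidean norm [enorm], so the library topology is used for limits,
   continuity and neighbourhoods. *)
Section Euclidean.
Context {R : realType} {M : nat}.
Implicit Types u v : 'rV[R]_M.

Definition edot u v : R := \sum_(i < M) u 0 i * v 0 i.

Definition enorm u : R := Num.sqrt (edot u u).

Definition enorm3 (V : 'rV[R]_M * 'rV[R]_M * 'rV[R]_M) : R :=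
  Num.sqrt (enorm V.1.1 ^+ 2 + enorm V.1.2 ^+ 2 + enorm V.2 ^+ 2).

End Euclidean.

Section Semiconvexity.
Context {R : realType} {M : nat}.
Implicit Types (F : 'rV[R]_M -> \bar R) (V W : 'rV[R]_M) (c : R).

Definition edom F : set 'rV[R]_M := [set V | (F V < +oo)%E].

Definition proper_function F : Prop :=
  (forall V, -oo < F V)%E /\ edom F !=set0.

(* With 0 * +oo = 0, the cases t = 0 and t = 1 are trivially true. *)
Definition econvex F : Prop :=
  forall (t : R) V W, 0 <= t -> t <= 1 ->
    (F (t *: V + (1 - t) *: W)%R <= t%:E * F V + (1 - t)%R%:E * F W)%E.

Definition semiconvex_with c F : Prop :=
  0 <= c /\ econvex (fun V => F V + (c / 2 * enorm V ^+ 2)%R%:E)%E.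

Definition semiconvex F : Prop := exists c, semiconvex_with c F.

(* c_F; the infimum is attained, see [semiconvexity_const_least]. *)
Definition semiconvexity_const F : R := inf [set c | semiconvex_with c F].

Definition subdiff F V : set 'rV[R]_M :=
  [set W | edom F V /\
    forall V', (F V' >= F V + (edot W (V' - V)
       - semiconvexity_const F / 2 * enorm (V' - V) ^+ 2)%R%:E)%E].

Let semiconvexity_inf (S : set R) (t x y z A B C : R) : has_inf S ->
  (forall c, S c -> z + c / 2 * A <=
     t * (x + c / 2 * B) + (1 - t) * (y + c / 2 * C)) ->
  z + inf S / 2 * A <=
    t * (x + inf S / 2 * B) + (1 - t) * (y + inf S / 2 * C).
Proof.
move=> hS key.
pose K := (t * B + (1 - t) * C - A) / 2.
have E c : t * (x + c / 2 * B) + (1 - t) * (y + c / 2 * C) - (z + c / 2 * A)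
    = t * x + (1 - t) * y - z + c * K by rewrite /K; field.
rewrite -subr_ge0 E; have {}key c : S c -> 0 <= t * x + (1 - t) * y - z + c * K.
  by move=> /key; rewrite -subr_ge0 E.
move: (_ - z) key => D key.
apply/ler_addgt0Pr => e e0.
have Kp : 0 < `|K| + 1 by rewrite ltr_wpDl.
have [|c Sc lc] := inf_adherent (eps := e / (`|K| + 1)) _ hS.
  by rewrite divr_gt0.
apply: (le_trans (key _ Sc)); rewrite -addrA lerD2l -lerBlDl -mulrBl.
apply: (@le_trans _ _ ((c - inf S) * (`|K| + 1))).
  apply: ler_wpM2l; last by rewrite (le_trans (ler_norm _))// lerDl.
  by rewrite subr_ge0; apply: ge_inf => //; case: hS.
by rewrite -ler_pdivlMr// lerBlDl ltW.
Qed.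

Lemma semiconvexity_const_least F : proper_function F -> semiconvex F ->
  semiconvex_with (semiconvexity_const F) F /\
  forall c, semiconvex_with c F -> semiconvexity_const F <= c.
Proof.
move=> [Fny _] [c0 Fc0]; set S := [set c | semiconvex_with c F].
have S0 : S !=set0 by exists c0.
have lbS : lbound S 0 by move=> c [].
have hS : has_inf S by split=> //; exists 0.
split; last by move=> c Sc; apply: ge_inf => //; exists 0.
split; first exact: lb_le_inf.
move=> t V W t0 t1.
have [->|tn0] := eqVneq t 0.
  by rewrite scale0r add0r subr0 scale1r mul0e add0e mul1e.
have [->|tn1] := eqVneq t 1.
  by rewrite scale1r subrr scale0r addr0 mul1e mul0e adde0.
have tp : 0 < t by rewrite lt_neqAle eq_sym tn0.
have tp' : 0 < 1 - t by rewrite subr_gt0 lt_neqAle tn1.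
have key c : S c -> (F (t *: V + (1 - t) *: W)%R +
    (c / 2 * enorm (t *: V + (1 - t) *: W) ^+ 2)%R%:E <=
    t%:E * (F V + (c / 2 * enorm V ^+ 2)%R%:E) +
    (1 - t)%R%:E * (F W + (c / 2 * enorm W ^+ 2)%R%:E))%E.
  by move=> [_]; apply.
move: (Fny V) (Fny W) (Fny (t *: V + (1 - t) *: W)) key.
set A := enorm (_ + _) ^+ 2; set B := enorm V ^+ 2; set C := enorm W ^+ 2.
case: (F V) => [x| |] // _; case: (F W) => [y| |] // _.
- case: (F _) => [z| |] // _ key; last by have := key _ Fc0.
  rewrite -!EFinD lee_fin.
  by apply: (semiconvexity_inf hS) => c /key.
- by move=> _ _; rewrite addye// mulry gtr0_sg// mul1e addey// leey.
- by move=> _ _; rewrite addye// mulry gtr0_sg// mul1e addye// leey.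
- by move=> _ _; rewrite !addye// !gt0_muley ?lte_fin// leey.
Qed.

End Semiconvexity.

Section QuadraticForms.
Context {R : realType}.

(* Quadratic forms on R^n are represented by their symmetric matrices. *)
Definition qform n (A : 'M[R]_n) (x : 'rV[R]_n) : R := (x *m A *m x^T) 0 0.

Definition posdef n (A : 'M[R]_n) : Prop :=
  A^T = A /\ forall x, x != 0 -> 0 < qform A x.

Definition vec2 (x1 x2 : R) : 'rV[R]_2 := \row_(i < 2) [:: x1; x2]`_i.

Definition vec3 (x1 x2 x3 : R) : 'rV[R]_3 := \row_(i < 3) [:: x1; x2; x3]`_i.

Definition gamma3 (x1 x2 x3 : R) : R :=
  11 / 6 * x1 ^+ 2 - 7 / 6 * x1 * x2 + 1 / 3 * x1 * x3.

Definition gamma3_decomposition (beta : R) (q : 'M[R]_2) (r : 'M[R]_3) : Prop :=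
  [/\ posdef q, posdef r &
      forall x1 x2 x3, gamma3 x1 x2 x3 =
        qform q (vec2 x1 x2) - qform q (vec2 x2 x3) + qform r (vec3 x1 x2 x3)
        + beta * x1 ^+ 2].

Definition beta3 : R :=
  sup [set beta | 0 < beta /\ exists q r, gamma3_decomposition beta q r].

End QuadraticForms.

Section Functional.
Context {R : realType} {M : nat}.
Local Notation vec := 'rV[R]_M.

(* a, 2b, c are q 0 0, 2 * q 0 1, q 1 1. *)
Definition Qform (q : 'M[R]_2) (V1 V2 : vec) : R :=
  q 0 0 * enorm V1 ^+ 2 + 2 * q 0 1 * edot V1 V2 + q 1 1 * enorm V2 ^+ 2.

Definition Fhat (F : vec -> \bar R) (dt : R) (q : 'M[R]_2)
    (V : vec * vec * vec) : \bar R :=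
  (F V.1.1 + (1 / dt * Qform q V.1.2 V.2)%:E)%E.

Definition subdiff_Fhat (F : vec -> \bar R) (dt : R) (q : 'M[R]_2)
    (V : vec * vec * vec) : set (vec * vec * vec) :=
  subdiff F V.1.1
  `*` [set (1 / dt) *: ((2 * q 0 0) *: V.1.2 + (2 * q 0 1) *: V.2)]
  `*` [set (1 / dt) *: ((2 * q 0 1) *: V.1.2 + (2 * q 1 1) *: V.2)].

End Functional.

Section KurdykaLojasiewicz.
Context {R : realType}.

(* dist(0, A); equal to +oo when A is empty. *)
Definition dist0 (T : Type) (nrm : T -> R) (A : set T) : \bar R :=
  ereal_inf [set (nrm w)%:E | w in A].

Definition desingularizing (eta : \bar R) (phi : R -> R) : Prop :=
  let I := [set s : R | 0 <= s /\ (s%:E < eta)%E] in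
  [/\ phi 0 = 0,
      forall s, I s -> 0 <= phi s,
      {within I, continuous phi},
      convex_function (I : set R^o) (fun s => - phi s) &
      forall s, 0 < s -> (s%:E < eta)%E ->
        [/\ derivable phi s 1, {for s, continuous (derive1 phi)} & 0 < derive1 phi s]].

Definition KL_property (T : topologicalType) (nrm : T -> R)
    (Phi : T -> \bar R) (dPhi : T -> set T) (x0 : T) : Prop :=
  dPhi x0 !=set0 /\
  exists (eta : \bar R) (N : set T) (phi : R -> R),
    [/\ (0 < eta)%E, nbhs x0 N, desingularizing eta phi &
        forall x, N x -> (Phi x0 < Phi x)%E -> (Phi x < Phi x0 + eta)%E ->
          (1 <= (derive1 phi (fine (Phi x - Phi x0)%E))%:E
                * dist0 nrm (dPhi x))%E].

End KurdykaLojasiewicz.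

Section Sequences.
Context {R : realType} {M : nat}.

Definition omega_limit (U : nat -> 'rV[R]_M) : set 'rV[R]_M :=
  [set Ustar | exists p : nat -> nat,
    p n @[n --> \oo] --> \oo /\ U (p n) @[n --> \oo] --> Ustar].

Definition BDF3 (F : 'rV[R]_M -> \bar R) (dt : R) (U : nat -> 'rV[R]_M) : Prop :=
  forall n, [set (- dt) *: W | W in subdiff F (U n.+3)]
    ((11 / 6) *: U n.+3 - 3 *: U n.+2 + (3 / 2) *: U n.+1 - (1 / 3) *: U n).

End Sequences.

(* Main.v *)
Require Import Defs.
From mathcomp Require Import all_boot all_order all_algebra.
From mathcomp Require Import all_classical all_reals all_analysis.
From mathcomp Require Import ring lra zify.
Import Order.TTheory GRing.Theory Num.Theory.
Import numFieldNormedType.Exports.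
Local Open Scope classical_set_scope.
Local Open Scope ring_scope.

(** Write [x_n = U_(n+1) - U_n]. Pairing the scheme with its last increment, the
    decomposition of [gamma3] and semiconvexity make the energy
    [E_n = Fhat (U_(n+3), x_(n+2), x_(n+1))] decrease by at least [k d_n^2], where
    [d_n = |x_(n+3)| + |x_(n+2)| + |x_(n+1)|], while the scheme gives a
    subgradient of [Fhat] at step [n+1] of size at most [C d_n]. Near
    [(Ustar, 0, 0)] the KL inequality and the concavity of [phi] then yield
    [2 d_(n+1) <= d_n + p_n - p_(n+1)] with [p_n = (C / k) phi (E_(n+1) - F Ustar)].
    Hence [|U_(n+4) - Ustar| + d_n + p_n] is nonincreasing once it is smaller
    than the radius of the KL neighbourhood; as it is arbitrarily small along
    the subsequence converging to [Ustar], it tends to 0. *)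

(** * Elementary inequalities and trapping of real sequences *)

(** By [4 a t <= (a + t)^2]. This turns the product bound coming from the KL inequality into an
    additive one that telescopes. *)
Lemma ler_sqrM_double (R : realFieldType) (x a t : R) :
  0 <= x -> 0 <= a -> 0 <= t -> x ^+ 2 <= a * t -> 2 * x <= a + t.
Proof.
move=> x0 a0 t0 xat; rewrite -ler_sqr ?nnegrE ?mulr_ge0 ?addr_ge0//.
have : 0 <= (a - t) ^+ 2 by exact: sqr_ge0.
rewrite !expr2 in xat *; nra.
Qed.

Lemma ler_discriminant (R : realFieldType) (a b c : R) : 0 <= c ->
  (forall t, 0 <= a - 2 * t * b + t ^+ 2 * c) -> b ^+ 2 <= a * c.
Proof.
rewrite le_eqVlt => /predU1P[<-|c0] abc.
  have [->|b0] := eqVneq b 0; first by rewrite expr0n mulr0.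
  (* For [c = 0] the polynomial is affine in [t]; if [b] were nonzero, it would take the value -1
     here. *)
  have := abc ((a + 1) / (2 * b)); rewrite mulr0 addr0.
  have -> : 2 * ((a + 1) / (2 * b)) * b = a + 1 by field.
  by move=> ?; exfalso; lra.
(* [b / c] is the minimiser of the quadratic polynomial. *)
have := abc (b / c).
have -> : a - 2 * (b / c) * b + (b / c) ^+ 2 * c = (a * c - b ^+ 2) / c.
  by field; rewrite gt_eqF.
by rewrite pmulr_lge0 ?invr_gt0// subr_ge0.
Qed.

(* [e n] is nonincreasing up to [d n.+1], which [p n] pays for; so
   [e n + d n + p n] is nonincreasing as soon as it is below [rho]. *)
Lemma potential_trapping (R : realDomainType) (e d p : nat -> R) (N : nat)
    (rho : R) :
  (forall n, 0 <= d n) -> (forall n, (N <= n)%N -> 0 <= p n) ->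
  (forall n, e n.+1 <= e n + d n.+1) ->
  (forall n, (N <= n)%N -> e n + d n < rho ->
    2 * d n.+1 <= d n + (p n - p n.+1)) ->
  (forall eps, 0 < eps -> exists2 n, (N <= n)%N & e n + d n + p n < eps) ->
  forall eps, 0 < eps -> eps <= rho ->
    exists m, forall n, (m <= n)%N -> e n < eps.
Proof.
move=> d0 p0 eS dS small eps eps0 eps_rho.
have [m Nm mlt] := small _ eps0; exists m => n mn.
suff : e n + d n + p n < eps.
  by have := d0 n; have := p0 n (leq_trans Nm mn); lra.
rewrite -(subnKC mn); elim: (n - m)%N => [|k]; first by rewrite addn0.
rewrite addnS; move: (m + k)%N (leq_trans Nm (leq_addr k m)) => l Nl IH.
have dl := dS _ Nl; have el := eS l; have pl := p0 _ Nl.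
(* Of the two copies of [d l.+1] bounded by [dl], one pays for the growth of [e], the other is the
   new [d] term of the potential. *)
by have := dl ltac:(lra); lra.
Qed.

(** * Concave desingularizing functions *)

(** By concavity, the slope of a chord ending at [s] is at least the slope of any shorter one;
    shrinking the shorter chord from the left gives the derivative. *)
Lemma concave_tangent (R : realType) (I : set R) (f : R -> R) (s t : R) :
  convex_function (I : set R^o) (fun x => - f x) -> I s -> I t -> t < s ->
  derivable f s 1 -> derive1 f s * (s - t) <= f s - f t.
Proof.
move=> cvx Is It ts df; have st0 : 0 < s - t by rewrite subr_gt0.
rewrite -ler_pdivlMr//.
have : (fun h => h^-1 *: (f (h + s) - f s)) @ 0^' --> derive1 f s.
  rewrite /derive1; move: df; rewrite /derivable.
  under [X in X @ _]eq_fun => h do rewrite /= [h%:A]mulr1.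
  by [].
move=> /cvg_dnbhs_at_left /cvgr_to_le; apply.
near=> h.
have h0 : h < 0 by near: h; exact: nbhs_left_lt.
have ht : t - s < h by near: h; apply: nbhs_left_gt; rewrite subr_lt0.
(* [- h / (s - t)] is the weight of [t] in the convex combination of [t] and [s] equal to
   [h + s]. *)
have l0 : 0 <= - h / (s - t) by rewrite divr_ge0 ?ltW ?oppr_gt0.
have l1 : - h / (s - t) <= 1 by rewrite ler_pdivrMr// mul1r; lra.
set l := - h / (s - t) in l0 l1 *.
have H : - f (l * t + (1 - l) * s) <= l * - f t + (1 - l) * - f s.
  by apply: (cvx (Itv01 l0 l1)); rewrite inE.
have E : l * t + (1 - l) * s = h + s by rewrite /l; field; rewrite gt_eqF.
rewrite E in H.
have {}E : l * - f t + (1 - l) * - f s = - (h * ((f s - f t) / (s - t)) + f s).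
  by rewrite /l; field; rewrite gt_eqF.
rewrite /GRing.scale/= ler_ndivrMl// -lerBlDr opprK -lerN2 -E.
exact: H.
Unshelve. all: by end_near. Qed.

Section Desingularizing.
Context {R : realType}.
Variables (eta : \bar R) (phi : R -> R).
Hypothesis phiP : desingularizing eta phi.

Lemma desingularizing_cvg0 (eps : R) : (0 < eta)%E -> 0 < eps ->
  exists2 del, 0 < del &
    forall s, 0 <= s -> (s%:E < eta)%E -> s < del -> phi s < eps.
Proof.
move=> eta0 eps0; have [phi0 _ phic _ _] := phiP.
move/subspace_continuousP : phic => /(_ 0 (conj (lexx _) eta0)).
move=> /cvgrPdist_lt/(_ _ eps0)/nbhs_ballP[del/= del0 delP].
exists del => // s s0 s_eta s_del.
have := delP s; rewrite /ball/= sub0r normrN ger0_norm// => /(_ s_del).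
by move=> /(_ (conj s0 s_eta)); rewrite /from_subspace phi0 sub0r normrN; apply/le_lt_trans/ler_norm.
Qed.

(** Here [s] and [t] are consecutive energy gaps. The tangent inequality, the decrease
    [k * d' ^+ 2 <= s - t] and the KL bound on the derivative combine into
    [d' ^+ 2 <= d * (C / k * (phi s - phi t))]; [ler_sqrM_double] then separates the factors. *)
Lemma desingularizing_step (k C s t d d' : R) : 0 < k -> 0 < C ->
  0 <= t -> 0 <= d -> 0 <= d' -> (s%:E < eta)%E ->
  t + k * d' ^+ 2 <= s -> (0 < s -> 1 <= derive1 phi s * (C * d)) ->
  2 * d' <= d + (C / k * phi s - C / k * phi t).
Proof.
move=> k0 C0 t0 d0 d'0 s_eta ts KL; have [_ _ _ cvx dphi] := phiP.
have kd0 : 0 <= k * d' ^+ 2 by rewrite mulr_ge0 ?sqr_ge0// ltW.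
(* If the gap does not decrease, then [d' = 0]. This covers [s = 0], where the KL inequality gives
   nothing. *)
have [t_eq_s|t_neq_s] := eqVneq t s.
  have : d' ^+ 2 <= 0 by rewrite -(pmulr_rle0 _ k0); lra.
  rewrite real_exprn_even_le0 ?num_real//= => /eqP ->.
  by rewrite t_eq_s subrr mulr0 addr0.
have t_lt_s : t < s by rewrite lt_neqAle t_neq_s; lra.
have s0 : 0 < s by exact: le_lt_trans t_lt_s.
have t_eta : (t%:E < eta)%E by apply: lt_trans s_eta; rewrite lte_fin.
have [ds _ _] := dphi _ s0 s_eta.
have tan : derive1 phi s * (s - t) <= phi s - phi t.
  by apply: concave_tangent cvx _ _ t_lt_s ds; split => //; exact: ltW.
have Cd0 : 0 <= C * d by rewrite mulr_ge0 ?(ltW C0).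
have D0 : 0 <= phi s - phi t.
  apply: le_trans tan; apply: mulr_ge0; rewrite ?subr_ge0 ?(ltW t_lt_s)//.
  by have [_ _ /ltW] := dphi _ s0 s_eta.
rewrite -mulrBr; apply: ler_sqrM_double => //.
  by rewrite mulr_ge0// divr_ge0 ?(ltW k0) ?(ltW C0).
have -> : d * (C / k * (phi s - phi t)) = (phi s - phi t) * (C * d) / k.
  by field; rewrite gt_eqF.
rewrite ler_pdivlMr// mulrC; apply: (@le_trans _ _ (s - t)); first by lra.
(* It remains to multiply [s - t] by the KL factor, which is at least 1. *)
apply: le_trans (ler_wpM2r Cd0 tan).
by rewrite mulrAC ler_peMl ?subr_ge0 ?(ltW t_lt_s)//; exact: KL.
Qed.

End Desingularizing.

(** * Sequences controlled by a decreasing energy *)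

(** [E] is nonincreasing and bounded below, hence convergent, so its successive differences, which
    dominate [k * d n ^+ 2], tend to 0. *)
Lemma cvg0_of_sqr_decrease (R : realType) (E d : nat -> R) (k : R) :
  0 < k -> (forall n, 0 <= d n) -> has_lbound (range E) ->
  (forall n, E n.+1 + k * d n ^+ 2 <= E n) -> d @ \oo --> 0.
Proof.
move=> k0 d0 lbE Ed.
have kd0 n : 0 <= k * d n ^+ 2 by rewrite mulr_ge0 ?sqr_ge0// ltW.
have /nonincreasing_is_cvgn/(_ lbE) cE : nonincreasing_seq E.
  by apply/nonincreasing_seqP => n; have := Ed n; have := kd0 n; lra.
have : (E n - E n.+1) @[n --> \oo] --> 0.
  rewrite -(subrr (limn E)); apply: cvgB => //.
  by have := cE; rewrite -(cvg_shiftS E).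
move=> /cvgr0Pnorm_lt h; apply/cvgr0Pnorm_lt => eps eps0.
near=> n; rewrite ger0_norm// -ltr_sqr ?nnegrE ?(ltW eps0)// -(ltr_pM2l k0).
apply: (@le_lt_trans _ _ `|E n - E n.+1|).
  by rewrite ger0_norm; have := Ed n; have := kd0 n; lra.
by near: n; apply: h; rewrite mulr_gt0 ?exprn_gt0.
Unshelve. all: by end_near. Qed.

(** * Positive definite quadratic forms *)

Section QuadraticForms.
Context {R : realType}.

(** The polynomial [qform A (x - t *: y)] in [t] is nonnegative, so its discriminant is not
    positive; symmetry of [A] merges the two cross terms. *)
Lemma qform_CauchySchwarz n (A : 'M[R]_n) (x y : 'rV[R]_n) :
  A^T = A -> (forall z, 0 <= qform A z) ->
  ((x *m A *m y^T) 0 0) ^+ 2 <= qform A x * qform A y.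
Proof.
move=> AT A0; apply: ler_discriminant => // t.
have yx : (y *m A *m x^T) 0 0 = (x *m A *m y^T) 0 0.
  have <- : (x *m A *m y^T)^T = y *m A *m x^T by rewrite !trmx_mul trmxK AT mulmxA.
  by rewrite [LHS]mxE.
suff -> : qform A x - 2 * t * (x *m A *m y^T) 0 0 + t ^+ 2 * qform A y
    = qform A (x - t *: y) by [].
have T : (x - t *: y)^T = x^T - t *: y^T by rewrite linearB/= linearZ.
rewrite /qform T !mulmxBl !mulmxBr -!(scalemxAl, scalemxAr).
move: (x *m A *m x^T) (x *m A *m y^T) (y *m A *m y^T) (y *m A *m x^T) yx.
by move=> a b c d dE; rewrite !mxE dE; ring.
Qed.

Lemma posdef_ge0 n (A : 'M[R]_n) (x : 'rV[R]_n) : posdef A -> 0 <= qform A x.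
Proof.
move=> [_ A0]; have [->|/A0/ltW//] := eqVneq x 0.
by rewrite /qform !mul0mx mxE.
Qed.

(* Cauchy-Schwarz for [A] against the rows of [A^-1]. *)
Lemma posdef_coercive n (A : 'M[R]_n) : posdef A ->
  exists2 m, 0 < m & forall x : 'rV_n, m * \sum_i x 0 i ^+ 2 <= qform A x.
Proof.
move=> pA; have [AT A0] := pA.
have uA : A \in unitmx.
  rewrite unitmxE unitfE; apply/negP => /det0P[v v0 vA].
  by have := A0 _ v0; rewrite /qform vA mul0mx mxE ltxx.
pose c i := qform A (row i (invmx A)).
have c0 i : 0 <= c i by exact: posdef_ge0.
(* The summand 1 makes the constant invertible from [0 <= c i] alone, including when [n = 0]. *)
have C0 : 0 < 1 + \sum_i c i by rewrite ltr_pwDl// sumr_ge0.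
exists (1 + \sum_i c i)^-1; first by rewrite invr_gt0.
move=> x; have x0 := posdef_ge0 _ _ x pA.
rewrite mulrC ler_pdivrMr// mulrDr mulr1 mulr_sumr ler_wpDl//.
apply: ler_sum => i _.
(* Each coordinate of [x] is its [A]-product with a row of the inverse, so its square is at most
   [qform A x * c i]. *)
suff -> : x 0 i = (x *m A *m (row i (invmx A))^T) 0 0.
  by apply: qform_CauchySchwarz => // z; exact: posdef_ge0.
by rewrite tr_row trmx_inv AT colE mulmxA mulmxK// -colE mxE.
Qed.

Lemma qform_vec2 (A : 'M[R]_2) x y : posdef A ->
  qform A (vec2 x y) = A 0 0 * x ^+ 2 + 2 * A 0 1 * (x * y) + A 1 1 * y ^+ 2.
Proof.
move=> [AT _]; have E : A 1 0 = A 0 1 by rewrite -[in LHS]AT mxE.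
rewrite /qform mxE !big_ord_recl big_ord0 !mxE !big_ord_recl !big_ord0 !mxE /=.
have -> : lift ord0 ord0 = 1 :> 'I_2 by exact/val_inj.
rewrite E; ring.
Qed.

End QuadraticForms.

(** * Euclidean norm and the topology it induces *)

Section Euclidean.
Context {R : realType} {M : nat}.
Implicit Types u v w : 'rV[R]_M.

Lemma edotC u v : edot u v = edot v u.
Proof. by apply: eq_bigr => i _; rewrite mulrC. Qed.

Lemma edotDr u v w : edot u (v + w) = edot u v + edot u w.
Proof. by rewrite -big_split; apply: eq_bigr => i _; rewrite mxE mulrDr. Qed.

Lemma edotZl a u v : edot (a *: u) v = a * edot u v.
Proof. by rewrite /edot mulr_sumr; apply: eq_bigr => i _; rewrite mxE mulrA. Qed.

Lemma enorm_ge0 u : 0 <= enorm u. Proof. exact: sqrtr_ge0. Qed.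

Lemma enorm_sqr u : enorm u ^+ 2 = \sum_i u 0 i ^+ 2.
Proof. by rewrite sqr_sqrtr ?sumr_ge0// => i _; rewrite -expr2 sqr_ge0. Qed.

Lemma edot_sqr u : edot u u = enorm u ^+ 2.
Proof. by rewrite enorm_sqr. Qed.

Lemma enormZ a u : enorm (a *: u) = `|a| * enorm u.
Proof.
rewrite /enorm edotZl edotC edotZl mulrA -expr2 sqrtrM ?sqr_ge0//.
by rewrite sqrtr_sqr.
Qed.

Lemma enorm0 : enorm (0 : 'rV[R]_M) = 0.
Proof. by rewrite -(scale0r (0 : 'rV[R]_M)) enormZ normr0 mul0r. Qed.

Lemma enormN u : enorm (- u) = enorm u.
Proof. by rewrite -scaleN1r enormZ normrN1 mul1r. Qed.

Lemma edot_le u v : `|edot u v| <= enorm u * enorm v.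
Proof.
rewrite -ler_sqr ?nnegrE ?mulr_ge0 ?enorm_ge0// exprMn real_normK ?num_real//.
(* Cauchy-Schwarz for the identity matrix. *)
have E w z : edot w z = (w *m 1%:M *m z^T) 0 0.
  by rewrite mulmx1 mxE; apply: eq_bigr => i _; rewrite mxE.
rewrite E -!edot_sqr !E; apply: qform_CauchySchwarz; first exact: trmx1.
by move=> z; rewrite /qform -E edot_sqr sqr_ge0.
Qed.

Lemma ler_enormD u v : enorm (u + v) <= enorm u + enorm v.
Proof.
rewrite -ler_sqr ?nnegrE ?addr_ge0 ?enorm_ge0//.
rewrite -edot_sqr edotDr ![edot (u + v) _]edotC !edotDr !edot_sqr [edot v u]edotC.
have := le_trans (ler_norm _) (edot_le u v); nra.
Qed.

Lemma normr_le_enorm u i : `|u 0 i| <= enorm u.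
Proof.
rewrite -ler_sqr ?nnegrE ?enorm_ge0// real_normK ?num_real// enorm_sqr.
by rewrite (bigD1 i)//= lerDl sumr_ge0// => j _; rewrite sqr_ge0.
Qed.

(** The sum of [M] squares is at most [e ^+ 2 * M / (M + 1) ^ 2]; dividing by [M.+1] rather than [M]
    keeps [M = 0] valid and the inequality strict. *)
Lemma enorm_lt u e : 0 < e -> (forall i, `|u 0 i| < e / M.+1%:R) -> enorm u < e.
Proof.
move=> e0 ue; have M0 : 0 < M.+1%:R :> R by rewrite ltr0n.
rewrite -ltr_sqr ?nnegrE ?enorm_ge0 ?ltW// enorm_sqr.
apply: (@le_lt_trans _ _ (\sum_(i < M) (e / M.+1%:R) ^+ 2)).
  apply: ler_sum => i _; rewrite -[leLHS]real_normK ?num_real//.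
  by apply: lerXn2r; rewrite ?nnegrE ?divr_ge0 ?(ltW e0) ?(ltW (ue i)).
rewrite sumr_const card_ord -[ltLHS]mulr_natr exprMn -mulrA.
rewrite gtr_pMr ?exprn_gt0// exprVn mulrC ltr_pdivrMr ?exprn_gt0// mul1r.
by rewrite -natrX ltr_nat expnS expn1 (leq_trans (ltnSn M))// leq_pmulr.
Qed.

(** Bridge from the sup-norm topology to Euclidean balls: each coordinate is bounded by [enorm], and
    conversely by [enorm_lt]. *)
Lemma nbhs_enormP v (N : set 'rV[R]_M) :
  nbhs v N <-> exists2 e, 0 < e & forall w, enorm (w - v) < e -> N w.
Proof.
split=> [/nbhs_ballP[e/= e0 eN]|[e e0 eN]].
  exists e => // w wv; apply: eN; split=> // i j.
  rewrite /ball/= ord1; apply: le_lt_trans wv.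
  by have := normr_le_enorm (w - v) j; rewrite !mxE distrC.
apply/nbhs_ballP; exists (e / M.+1%:R); first by rewrite /= divr_gt0.
move=> w [_ wv]; apply: eN; apply: enorm_lt => // i.
by have := wv 0 i; rewrite /ball/= !mxE distrC.
Qed.

Lemma cvg_enormP {T} {G : set_system T} {FG : Filter G} (f : T -> 'rV[R]_M) v :
  f @ G --> v <-> forall e, 0 < e -> \forall t \near G, enorm (f t - v) < e.
Proof.
split=> [fv e e0|fv N /nbhs_enormP[e e0 eN]].
  by apply: (fv [set w | enorm (w - v) < e]); apply/nbhs_enormP; exists e.
by apply: filterS (fv _ e0) => t; exact: eN.
Qed.

End Euclidean.

(** * Quadratic forms on vectors, treated coordinate by coordinate *)

Section VectorForms.
Context {R : realType} {M : nat}.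
Implicit Types (q : 'M[R]_2) (x y z : 'rV[R]_M).

Lemma Qform_sum q x y : posdef q ->
  Qform q x y = \sum_i qform q (vec2 (x 0 i) (y 0 i)).
Proof.
move=> pq; rewrite /Qform !enorm_sqr /edot !mulr_sumr -!big_split/=.
by apply: eq_bigr => i _; rewrite qform_vec2.
Qed.

Lemma Qform_ge0 q x y : posdef q -> 0 <= Qform q x y.
Proof. by move=> pq; rewrite Qform_sum// sumr_ge0// => i _; exact: posdef_ge0. Qed.

Lemma Qform_le q x y : Qform q x y <=
  (`|q 0 0| + `|q 0 1| + `|q 1 1|) * (enorm x + enorm y) ^+ 2.
Proof.
have x0 := enorm_ge0 x; have y0 := enorm_ge0 y.
have bound (c s : R) : `|s| <= (enorm x + enorm y) ^+ 2 ->
    c * s <= `|c| * (enorm x + enorm y) ^+ 2.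
  by move=> sxy; rewrite (le_trans (ler_norm _))// normrM ler_wpM2l.
rewrite [leRHS]mulrDl; apply: lerD; first rewrite [leRHS]mulrDl; first apply: lerD.
- by apply: bound; rewrite ger0_norm ?sqr_ge0//; nra.
- rewrite -mulrA mulrCA; apply: bound; rewrite normrM normr_nat.
  by have := edot_le x y; nra.
- by apply: bound; rewrite ger0_norm ?sqr_ge0//; nra.
Qed.

(** The BDF3 combination of four iterates expressed in their increments, latest first. *)
Definition gamma3_vec x y z : 'rV[R]_M :=
  (11 / 6) *: x - (7 / 6) *: y + (1 / 3) *: z.

Lemma edot_gamma3_vec x y z :
  edot (gamma3_vec x y z) x = \sum_i gamma3 (x 0 i) (y 0 i) (z 0 i).
Proof. by apply: eq_bigr => i _; rewrite !mxE /gamma3; ring. Qed.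

Lemma enorm_gamma3_vec x y z :
  enorm (gamma3_vec x y z) <= 11 / 6 * (enorm x + enorm y + enorm z).
Proof.
have x0 := enorm_ge0 x; have y0 := enorm_ge0 y; have z0 := enorm_ge0 z.
apply: le_trans (ler_enormD _ _) _; rewrite enormZ ger0_norm; last by lra.
have := ler_enormD ((11 / 6) *: x) (- ((7 / 6) *: y)).
rewrite enormN !enormZ !ger0_norm; lra.
Qed.

(** The scalar decomposition of [gamma3] is summed over coordinates; coercivity of [r] supplies the
    term in [m]. *)
Lemma gamma3_vec_ge beta q r : gamma3_decomposition beta q r ->
  exists2 m, 0 < m & forall x y z, Qform q x y - Qform q y z +
    beta * enorm x ^+ 2 + m * (enorm x ^+ 2 + enorm y ^+ 2 + enorm z ^+ 2)
    <= edot (gamma3_vec x y z) x.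
Proof.
move=> [pq pr E]; have [m m0 mP] := posdef_coercive _ _ pr.
exists m => // x y z; rewrite edot_gamma3_vec !Qform_sum// !enorm_sqr.
rewrite -sumrB -!big_split/= !mulr_sumr -!big_split/=.
apply: ler_sum => i _; rewrite E addrAC lerD2r lerD2l.
apply: le_trans (mP _); rewrite !big_ord_recl big_ord0 !mxE/= addr0 addrA.
exact: lexx.
Qed.

Lemma enorm3_le x y z : enorm3 (x, y, z) <= enorm x + enorm y + enorm z.
Proof.
have x0 := enorm_ge0 x; have y0 := enorm_ge0 y; have z0 := enorm_ge0 z.
rewrite -ler_sqr ?nnegrE ?sqrtr_ge0 ?addr_ge0// sqr_sqrtr ?addr_ge0 ?sqr_ge0//=.
nra.
Qed.

End VectorForms.

(** * Energy decrease and subgradient bound for the scheme *)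

Section BDF3.
Context {R : realType} {M : nat}.
Variables (F : 'rV[R]_M -> \bar R) (dt : R) (U : nat -> 'rV[R]_M).
Hypotheses (F_proper : proper_function F) (dt_gt0 : 0 < dt)
  (U_BDF3 : BDF3 F dt U).

Definition increment n := U n.+1 - U n.

Definition increment3 n :=
  enorm (increment n.+3) + enorm (increment n.+2) + enorm (increment n.+1).

Lemma increment3_ge0 n : 0 <= increment3 n.
Proof. by rewrite !addr_ge0 ?enorm_ge0. Qed.

(** The coefficients of the scheme sum to zero, so it depends on the increments only. *)
Lemma bdf3_subdiff n : subdiff F (U n.+3)
  (- dt^-1 *: gamma3_vec (increment n.+2) (increment n.+1) (increment n)).
Proof.
have [W FW WE] := U_BDF3 n.
suff -> : gamma3_vec (increment n.+2) (increment n.+1) (increment n)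
    = - dt *: W by rewrite scalerA mulrNN mulVf ?scale1r// gt_eqF.
by rewrite WE; apply/rowP => i; rewrite /gamma3_vec /increment !mxE; field.
Qed.

Lemma bdf3_fin_num n : F (U n.+3) \is a fin_num.
Proof.
have [dF _] := bdf3_subdiff n.
by rewrite fin_numElt F_proper.1.
Qed.

(** The shift by 3 starts at the first iterate that the scheme places in the domain of [F]. *)
Definition bdf3_state n := (U n.+3, increment n.+2, increment n.+1).

Variables (q : 'M[R]_2).

Definition energy n := fine (F (U n.+3)) +
  1 / dt * Qform q (increment n.+2) (increment n.+1).

Lemma Fhat_bdf3_state n : Fhat F dt q (bdf3_state n) = (energy n)%:E.
Proof. by rewrite /Fhat /= -[F _](fineK (bdf3_fin_num n)). Qed.

(** The subgradient inequality at [U n.+4] is tested at [U n.+3]; [gamma3_vec_ge] bounds the scalar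
    product from below, and its [beta] term absorbs the semiconvexity defect. *)
Lemma energy_decrease beta r : semiconvexity_const F * dt / 2 <= beta ->
  gamma3_decomposition beta q r ->
  exists2 k, 0 < k & forall n, energy n.+1 + k * increment3 n ^+ 2 <= energy n.
Proof.
move=> beta_ge qr; have [m m0 mP] := gamma3_vec_ge (M := M) _ _ _ qr.
(* The 3 comes from [(a + b + c)^2 <= 3 (a^2 + b^2 + c^2)]. *)
exists (m / dt / 3); first by rewrite !divr_gt0.
move=> n; have [_ /(_ (U n.+3))] := bdf3_subdiff n.+1.
rewrite -[F (U n.+4)](fineK (bdf3_fin_num _)) -[F (U n.+3)](fineK (bdf3_fin_num _)).
rewrite -EFinD lee_fin.
have -> : U n.+3 - U n.+4 = - increment n.+3 by rewrite opprB.
rewrite enormN edotZl -[- increment _]scaleN1r edotC edotZl edotC.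
set x := increment n.+3; set y := increment n.+2; set z := increment n.+1.
move=> H; have := mP x y z; rewrite -(ler_pM2l (x := dt^-1)) ?invr_gt0// => K.
rewrite /energy /increment3 -/x -/y -/z.
have L : semiconvexity_const F / 2 * enorm x ^+ 2 <= dt^-1 * (beta * enorm x ^+ 2).
  rewrite [leRHS]mulrA ler_wpM2r ?sqr_ge0// [leRHS]mulrC ler_pdivlMr//.
  by rewrite mulrAC.
have d0 : 0 < m / dt by rewrite divr_gt0.
have S : m / dt / 3 * (enorm x + enorm y + enorm z) ^+ 2 <=
   dt^-1 * (m * (enorm x ^+ 2 + enorm y ^+ 2 + enorm z ^+ 2)).
  rewrite [leRHS]mulrA [dt^-1 * m]mulrC -mulrA ler_pM2l// mulrC ler_pdivrMr//.
  have := sqr_ge0 (enorm x - enorm y); have := sqr_ge0 (enorm y - enorm z).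
  by have := sqr_ge0 (enorm x - enorm z); nra.
by rewrite mulN1r mulrNN in H; rewrite div1r; lra.
Qed.

Lemma dist0_bdf3_state : exists2 C, 0 < C & forall n,
  (dist0 enorm3 (subdiff_Fhat F dt q (bdf3_state n.+1)) <=
   (C * increment3 n)%:E)%E.
Proof.
(* 11/6 bounds the [gamma3_vec] component, the other terms the two partial gradients of [Qform];
   [q 0 1] occurs in both, hence the 4. *)
pose K : R := 11 / 6 + 2 * `|q 0 0| + 4 * `|q 0 1| + 2 * `|q 1 1|.
have K0 : 0 < K by rewrite /K; have := normr_ge0 (q 0 0); have := normr_ge0 (q 0 1);
  have := normr_ge0 (q 1 1); lra.
exists (dt^-1 * K) => [|n]; first by rewrite mulr_gt0 ?invr_gt0.
set x := increment n.+3; set y := increment n.+2; set z := increment n.+1.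
pose w := (- dt^-1 *: gamma3_vec x y z,
  (1 / dt) *: ((2 * q 0 0) *: x + (2 * q 0 1) *: y),
  (1 / dt) *: ((2 * q 0 1) *: x + (2 * q 1 1) *: y)).
apply: (@le_trans _ _ (enorm3 w)%:E).
  apply: ereal_inf_lbound; exists w => //; split=> //; split=> //.
  exact: bdf3_subdiff.
rewrite lee_fin (le_trans (enorm3_le _ _ _))//.
rewrite !enormZ normrN !div1r ger0_norm ?invr_ge0 ?(ltW dt_gt0)// -!mulrDr -mulrA.
rewrite ler_pM2l ?invr_gt0//.
have x0 := enorm_ge0 x; have y0 := enorm_ge0 y; have z0 := enorm_ge0 z.
have := enorm_gamma3_vec x y z.
have := ler_enormD ((2 * q 0 0) *: x) ((2 * q 0 1) *: y).
have := ler_enormD ((2 * q 0 1) *: x) ((2 * q 1 1) *: y).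
rewrite !enormZ !normrM normr_nat /increment3 -/x -/y -/z /K.
have := normr_ge0 (q 0 0); have := normr_ge0 (q 0 1); have := normr_ge0 (q 1 1).
move: `|_| `|_| `|_| => a b c; nra.
Qed.

End BDF3.

(** * Convergence from the KL inequality *)

Lemma nbhs_enorm3 (R : realType) (M : nat) (V : 'rV[R]_M * 'rV[R]_M * 'rV[R]_M)
    (N : set ('rV[R]_M * 'rV[R]_M * 'rV[R]_M)) : nbhs V N ->
  exists2 e, 0 < e & forall x y z, enorm (x - V.1.1) < e ->
    enorm (y - V.1.2) < e -> enorm (z - V.2) < e -> N (x, y, z).
Proof.
case: V => [[a b] c] [[P Q]/= [[[P1 P2]/= [P1a P2b] PP] Qc] PQ].
have [e1 e10 h1] := (nbhs_enormP _ _).1 P1a.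
have [e2 e20 h2] := (nbhs_enormP _ _).1 P2b.
have [e3 e30 h3] := (nbhs_enormP _ _).1 Qc.
exists (Num.min e1 (Num.min e2 e3)); first by rewrite !lt_min e10 e20 e30.
move=> x y z; rewrite !lt_min => /andP[xa _] /and3P[_ yb _] /and3P[_ _ zc].
by apply: (PQ (x, y, z)); split; [apply: PP; split; [exact: h1|exact: h2]|exact: h3].
Qed.

Section Convergence.
Context {R : realType} {M : nat}.
Variables (F : 'rV[R]_M -> \bar R) (dt : R) (U : nat -> 'rV[R]_M) (q : 'M[R]_2)
  (Ustar : 'rV[R]_M).
Hypotheses (F_proper : proper_function F) (dt_gt0 : 0 < dt)
  (F_continuous : {within edom F, continuous F})
  (U_BDF3 : BDF3 F dt U) (q_posdef : posdef q)
  (dom_Ustar : edom F Ustar)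
  (Ustar_omega : omega_limit U Ustar)
  (increment3_cvg0 : increment3 U @ \oo --> 0).

Local Notation E := (energy F dt U q).
Local Notation Fs := (fine (F Ustar)).

Lemma fin_num_Ustar : F Ustar \is a fin_num.
Proof. by rewrite fin_numElt F_proper.1. Qed.

(** Along the subsequence, [F] converges by continuity on its domain, and the quadratic part of the
    energy vanishes with the increments. *)
Lemma omega_limit_energy (eps : R) (N : nat) : 0 < eps ->
  exists n, [/\ (N <= n)%N, enorm (U n.+4 - Ustar) < eps, increment3 U n < eps,
    Fs - eps < E n.+1 & E n.+1 < Fs + eps].
Proof.
move=> eps0; have [p [p_oo Up]] := Ustar_omega.
have ge_p m : \forall k \near \oo, (m <= p k)%N.
  by apply: (p_oo [set n | (m <= n)%N]); exists m.
have Fp : fine (F (U (p k))) @[k --> \oo] --> Fs.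
  apply: fine_cvg; rewrite (fineK fin_num_Ustar).
  move/subspace_continuousP : F_continuous => /(_ _ dom_Ustar).
  apply: cvg_comp => A /= /Up UA.
  near=> k; have : edom F (U (p k)) -> A (U (p k)) by near: k; exact: UA.
  (* Continuity holds relative to the domain only, which contains the iterates of index at least
     3. *)
  apply; have pk3 : (3 <= p k)%N by near: k; exact: ge_p.
  by have [+ _] := bdf3_subdiff F dt U dt_gt0 U_BDF3 (p k - 3)%N; rewrite -addn3 subnK.
have [K K0 KQ] : exists2 K, 0 <= K & forall n,
    1 / dt * Qform q (increment U n.+3) (increment U n.+2) <= K * increment3 U n ^+ 2.
  exists (dt^-1 * (`|q 0 0| + `|q 0 1| + `|q 1 1|)).
    by rewrite mulr_ge0 ?invr_ge0 ?(ltW dt_gt0)// !addr_ge0.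
  move=> n; rewrite div1r -mulrA ler_pM2l ?invr_gt0//.
  apply: le_trans (Qform_le _ _ _) _; rewrite ler_wpM2l ?addr_ge0//.
  by apply: lerXn2r; rewrite ?nnegrE ?addr_ge0 ?enorm_ge0// lerDl enorm_ge0.
have Kd : (K * increment3 U n ^+ 2) @[n --> \oo] --> 0.
  by rewrite -(mulr0 K) -(mulr0 0); apply: cvgMr; exact: cvgM.
have [n0 _ n0P] := (cvgr0Pnorm_lt _).1 increment3_cvg0 _ eps0.
have [n1 _ n1P] := (cvgr0Pnorm_lt _).1 Kd _ (divr_gt0 eps0 (ltr0n _ 2)).
(* The margin 4 makes the natural subtraction in [p k - 4] exact, so that [n.+4] is [p k]. *)
have [k [kge kU kF]] : exists k, [/\ (N + n0 + n1 + 4 <= p k)%N,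
    enorm (U (p k) - Ustar) < eps & `|Fs - fine (F (U (p k)))| < eps / 2].
  near \oo => k; exists k; split; first by near: k; exact: ge_p.
    by near: k; exact: (cvg_enormP _ _).1 Up _ eps0.
  by near: k; move/cvgrPdist_lt : Fp; apply; rewrite divr_gt0.
exists (p k - 4)%N.
have pk : (p k - 4).+4 = p k by lia.
have := n0P (p k - 4)%N; rewrite /= ger0_norm ?increment3_ge0// => dlt.
have := n1P (p k - 4)%N; rewrite /= ger0_norm ?(mulr_ge0 K0 (sqr_ge0 _))// => Kdlt.
have {}Kdlt : K * increment3 U (p k - 4) ^+ 2 < eps / 2 by apply: Kdlt; lia.
have Q0 := Qform_ge0 _ (increment U (p k - 4).+3) (increment U (p k - 4).+2) q_posdef.
have {}Q0 := mulr_ge0 (ltW (divr_gt0 ltr01 dt_gt0)) Q0.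
have := KQ (p k - 4)%N; move: kF; rewrite ltr_norml => /andP[? ?] ?.
by split; rewrite ?pk//; [lia|apply: dlt; lia|rewrite /energy pk; lra..].
Unshelve. all: by end_near. Qed.

Hypothesis energy_noninc : nonincreasing_seq E.

(** Were [E n] below the limit value, monotonicity would keep all later energies at or below [E n],
    contradicting [omega_limit_energy] with [eps = Fs - E n]. *)
Lemma energy_ge n : Fs <= E n.
Proof.
rewrite leNgt; apply/negP => En; rewrite -subr_gt0 in En.
have [m [nm _ _ mlt _]] := omega_limit_energy _ n En.
have := energy_noninc n m.+1 (leq_trans nm (leqnSn m)); lra.
Qed.

Variables (k C : R).
Hypotheses (k_gt0 : 0 < k) (C_gt0 : 0 < C)
  (energyS : forall n, E n.+1 + k * increment3 U n ^+ 2 <= E n)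
  (distP : forall n, (dist0 enorm3 (subdiff_Fhat F dt q (bdf3_state U n.+1)) <=
     (C * increment3 U n)%:E)%E).

Lemma KL_cvg :
  KL_property (@enorm3 R M) (Fhat F dt q) (subdiff_Fhat F dt q) (Ustar, 0, 0) ->
  U @ \oo --> Ustar.
Proof.
move=> [_ [eta [N [phi [eta0 nN phiP KL]]]]].
have [rho rho0 rhoP] := nbhs_enorm3 _ _ _ _ nN.
have FhatU : Fhat F dt q (Ustar, 0, 0) = Fs%:E.
  rewrite /Fhat/= -[F _](fineK fin_num_Ustar) -EFinD.
  by rewrite /Qform edot_sqr enorm0 expr0n/= !mulr0 !addr0 mulr0 addr0.
pose s n := E n - Fs.
have s0 n : 0 <= s n by rewrite subr_ge0 energy_ge.
have small_s del : 0 < del -> exists n0, forall n, (n0 <= n)%N -> s n.+1 < del.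
  move=> del0; have [n0 [_ _ _ _ n0P]] := omega_limit_energy _ 0 del0.
  exists n0 => n n0n; rewrite /s ltrBlDl.
  by apply: le_lt_trans n0P; exact: energy_noninc.
have [n1 s_eta] : exists n1, forall n, (n1 <= n)%N -> ((s n.+1)%:E < eta)%E.
  case: (eta) eta0 => [a| |]//; last by exists 0%N => n _; exact: ltry.
  by rewrite lte_fin => /small_s[n1 n1P]; exists n1 => n /n1P; rewrite lte_fin.
apply/cvg_enormP => eps eps0.
pose eps1 := Num.min eps rho.
have eps10 : 0 < eps1 by rewrite lt_min eps0.
have [||||||m mP] := potential_trapping R (fun n => enorm (U n.+4 - Ustar))
    (increment3 U) (fun n => C / k * phi (s n.+1)) n1 rho _ _ _ _ _ eps1 eps10.
- by move=> n; exact: increment3_ge0.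
- move=> n /s_eta sn; rewrite mulr_ge0 ?divr_ge0 ?(ltW C_gt0) ?(ltW k_gt0)//.
  by have [_ + _ _ _] := phiP; apply.
- move=> n; have -> : U n.+4.+1 - Ustar = (U n.+4 - Ustar) + increment U n.+4.
    by rewrite /increment [RHS]addrC subrKA.
  apply: le_trans (ler_enormD _ _) _; rewrite lerD2l /increment3 -addrA lerDl.
  by rewrite addr_ge0 ?enorm_ge0.
- move=> n n1n near_n.
  have e0 := enorm_ge0 (U n.+4 - Ustar).
  have x0 := enorm_ge0 (increment U n.+3); have y0 := enorm_ge0 (increment U n.+2).
  have z0 := enorm_ge0 (increment U n.+1).
  apply: (desingularizing_step eta phi phiP k C) => //; try exact: increment3_ge0.
  + exact: s_eta.
  + by rewrite /s addrAC lerD2r.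
  move=> sn0; have sn_eta := s_eta _ n1n.
  have dphi0 : 0 <= derive1 phi (s n.+1).
    by have [_ _ _ _ /(_ _ sn0 sn_eta)[_ _ /ltW]] := phiP.
  have Nz : N (bdf3_state U n.+1).
    (* [increment3 U n] contains both increments of the state [n.+1], so [near_n] puts all three
       components within [rho]. *)
    have ltd := near_n; rewrite /increment3 in ltd.
    by apply: rhoP; rewrite /= ?subr0; lra.
  have := KL _ Nz; rewrite FhatU Fhat_bdf3_state// lte_fin -subr_gt0 -/(s n.+1).
  rewrite -lteBlDl// -EFinB => /(_ sn0 sn_eta) /le_trans; rewrite -lee_fin EFinM; apply.
  by apply: lee_wpmul2l; [rewrite lee_fin|exact: distP].
- move=> e e_gt0.
  have e3 : 0 < e / 3 by rewrite divr_gt0.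
  (* Each of the three terms of the potential gets [e / 3]; the factor [k / C] cancels the scaling
     of [phi]. *)
  have e3' : 0 < e / 3 * (k / C) by rewrite mulr_gt0 ?divr_gt0.
  have [del del0 delP] := desingularizing_cvg0 eta phi phiP _ eta0 e3'.
  have [n2 n2P] := small_s _ del0.
  have [n [nn nU nd _ _]] := omega_limit_energy _ (n1 + n2) e3.
  have n1n : (n1 <= n)%N by exact: leq_trans (leq_addr _ _) nn.
  have n2n : (n2 <= n)%N by exact: leq_trans (leq_addl _ _) nn.
  exists n => //.
  have : C / k * phi (s n.+1) < e / 3.
    rewrite -ltr_pdivlMl ?divr_gt0// invf_div mulrC.
    by apply: delP; [exact: s0|exact: s_eta|exact: n2P].
  lra.
- by rewrite ge_min lexx orbT.
(* The trapped quantity at [n] concerns [U n.+4]. *)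
exists m.+4 => // -[|[|[|[|n]]]]//= mn; apply: lt_le_trans (mP n _) _ => //.
by rewrite ge_min lexx.
Qed.

End Convergence.

(** * Convergence of bounded BDF3 sequences *)

Theorem corollary3p8 (R : realType) (M : nat) (F : 'rV[R]_M -> \bar R)
    (F_proper : proper_function F)
    (F_lsc : lower_semicontinuous F)
    (F_semiconvex : semiconvex F)
    (F_continuous : {within edom F, continuous F})
    (F_bounded_below : (-oo < ereal_inf (range F))%E)
    (dt : R) (dt_gt0 : 0 < dt)
    (dt_small : semiconvexity_const F * dt < 2 * beta3)
    (U : nat -> 'rV[R]_M)
    (U_bounded : exists B : R, forall n, enorm (U n) <= B)
    (U_BDF3 : BDF3 F dt U)
    (beta : R)
    (beta_ge : semiconvexity_const F * dt / 2 <= beta)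
    (beta_lt : beta < beta3)
    (q : 'M[R]_2) (r : 'M[R]_3)
    (qr_beta : gamma3_decomposition beta q r)
    (Ustar : 'rV[R]_M)
    (Ustar_omega : omega_limit U Ustar)
    (Fhat_KL : KL_property (@enorm3 R M) (Fhat F dt q) (subdiff_Fhat F dt q)
                 (Ustar, 0, 0)) :
  U n @[n --> \oo] --> Ustar.
Proof.
have [q_posdef _ _] := qr_beta.
(* The KL property includes a nonempty subdifferential at the point, hence [F Ustar < +oo]. *)
have dom_Ustar : edom F Ustar by have [[w [[[] ]]]] := Fhat_KL.
have [k k_gt0 energyS] :=
  energy_decrease F dt U F_proper dt_gt0 U_BDF3 q beta r beta_ge qr_beta.
have [C C_gt0 distP] := dist0_bdf3_state F dt U dt_gt0 U_BDF3 q.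
have energy_lb : has_lbound (range (energy F dt U q)).
  have inf_le n := ereal_inf_lbound (imageT F (U n.+3)).
  case: (ereal_inf _) F_bounded_below inf_le => [m _ m_le|_ m_le|//].
    exists m => _ [n _ <-]; apply: ler_wpDr.
      by rewrite mulr_ge0 ?Qform_ge0// divr_ge0// ltW.
    by rewrite -lee_fin fineK ?m_le// (bdf3_fin_num F dt).
  (* An infimum equal to [+oo] is excluded by [U 3], which lies in the domain. *)
  have [+ _] := bdf3_subdiff F dt U dt_gt0 U_BDF3 0.
  by rewrite /edom/= ltNge m_le.
have energy_noninc : nonincreasing_seq (energy F dt U q).
  apply/nonincreasing_seqP => n; apply: le_trans (energyS n).
  by rewrite lerDl mulr_ge0 ?sqr_ge0// ltW.
apply: (KL_cvg F dt U q Ustar F_proper dt_gt0 F_continuous U_BDF3 q_posdef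
  dom_Ustar Ustar_omega _ energy_noninc k C) => //.
by apply: cvg0_of_sqr_decrease k_gt0 _ energy_lb energyS => n; exact: increment3_ge0.
Qed.
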